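(* Let $g(|x_i|)$ be strictly concave, increasing and differentiable in its domain $D\subseteq\mathbb{R}_+$ (for $|x_i|=0$, the right derivative is considered). Let $A\in\mathbb{R}^{m\times n}$, $y\in\mathbb{R}^m$, $\lambda>0$, and define the functional $$\mathcal{F}:X\times Y\to\mathbb{R},\quad X\subseteq\mathbb{R}^n,\ Y\subseteq\mathbb{R}_+^n,\qquad \mathcal{F}(x,w):=\frac12\|y-Ax\|_2^2+\lambda\sum_{i=1}^n\bigl[w_i|x_i|+h(w_i)\bigr],$$ where $h:H\subseteq\mathbb{R}_+\to\mathbb{R}_+$ is defined by $h'=-(g')^{-1}$, with $(\cdot)^{-1}$ indicating the inverse function. Then $\mathcal{F}$ is biconvex, and the Lasso IRL1 algorithm (defined in the context) is an alternated convex search (ACS) for $\mathcal{F}$.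
   Context: $\mathbb{R}_+=[0,+\infty)$. The function $h$ is determined by $h'=-(g')^{-1}$ up to an integration constant, which can be set arbitrarily. Biconvexity: a function $f:X\times Y\to\mathbb{R}$ is biconvex if it is convex in its second variable for any fixed $x\in X$, and convex in its first variable for any fixed element of $Y$. Alternated convex search (ACS) for a biconvex $f$: the algorithm that iteratively minimizes $f$ with respect to each of its two variables in turn, the other being fixed at its current value, so that each iteration is the solution of a convex problem. Lasso IRL1 algorithm: given $x(0)\in\mathbb{R}^n$ and $\lambda>0$, for $t=0,1,2,\dots$ (until a stopping time) set $w_i(t)=g'(|x_i(t)|)$ for any $i\in\{1,\dots,n\}$, and $$x(t+1)=\operatorname{argmin}_{x\in\mathbb{R}^n}\ \frac12\|y-Ax\|_2^2+\lambda\sum_{i=1}^n w_i(t)|x_i|.$$ *)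

(* Defs.v *)
From HB Require Import structures.
From mathcomp Require Import all_boot all_order all_algebra.
From mathcomp Require Import all_classical all_reals all_analysis.

Set Implicit Arguments.
Unset Strict Implicit.
Unset Printing Implicit Defensive.

Import Order.TTheory GRing.Theory Num.Theory.
Import numFieldNormedType.Exports.

Local Open Scope classical_set_scope.
Local Open Scope ring_scope.

Definition strictly_concave_on (R : realType) (D : set R) (g : R -> R) : Prop :=
  forall a b s : R, D a -> D b -> a != b -> 0 < s -> s < 1 ->
    s * g a + (1 - s) * g b < g (s * a + (1 - s) * b).

Definition increasing_on (R : realType) (D : set R) (g : R -> R) : Prop :=
  forall a b : R, D a -> D b -> a < b -> g a < g b.

(* The difference quotient at z only uses points of D, so at an end point of an
   interval D this is the one-sided derivative. When z is isolated in D the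
   filter is trivial and the condition is void. *)
Definition has_derivative_on (R : realType) (D : set R) (f df : R -> R) : Prop :=
  forall z : R, D z ->
    (f u - f z) / (u - z) @[u --> within D z^'] --> df z.

Definition is_argmin (R : realType) (U : Type) (S : set U) (f : U -> R) (u : U)
    : Prop :=
  S u /\ forall v, S v -> f u <= f v.

Definition biconvex (R : realType) (U V : lmodType R) (X : set U) (Y : set V)
    (f : U -> V -> R) : Prop :=
  [/\ convex_set X, convex_set Y,
      forall u, X u -> convex_function Y (f u)
    & forall v, Y v -> convex_function X (f ^~ v)].

(* Minimisers need not be unique, so an alternated convex search may move to any
   of them. The run stops at time T; u and v are unconstrained afterwards. *)
Definition acs_run (R : realType) (U V : lmodType R) (X : set U) (Y : set V)
    (f : U -> V -> R) (T : nat) (u : nat -> U) (v : nat -> V) : Prop :=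
  X (u 0%N) /\
  forall t, (t < T)%N ->
    is_argmin Y (f (u t)) (v t) /\ is_argmin X (f ^~ (v t)) (u t.+1).

(* The norm of the library on matrices is the sup norm. *)
Definition sqnorm2 (R : realType) (m : nat) (v : 'cV[R]_m) : R :=
  \sum_(i < m) v i 0 ^+ 2.

Definition weighted_lasso (R : realType) (m n : nat) (A : 'M[R]_(m, n))
    (y : 'cV[R]_m) (lambda : R) (w x : 'cV[R]_n) : R :=
  2^-1 * sqnorm2 (y - A *m x) + lambda * \sum_(i < n) w i 0 * `|x i 0|.

(* dg is only meaningful on D, so the weight update requires `|x_i(t)| in D. *)
Definition lasso_irl1_run (R : realType) (m n : nat) (A : 'M[R]_(m, n))
    (y : 'cV[R]_m) (lambda : R) (D : set R) (dg : R -> R) (T : nat)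
    (x w : nat -> 'cV[R]_n) : Prop :=
  forall t, (t < T)%N ->
    (forall i, D `|x t i 0| /\ w t i 0 = dg `|x t i 0|) /\
    is_argmin setT (weighted_lasso A y lambda (w t)) (x t.+1).

Definition irl1_functional (R : realType) (m n : nat) (A : 'M[R]_(m, n))
    (y : 'cV[R]_m) (lambda : R) (h : R -> R) (x w : 'cV[R]_n) : R :=
  2^-1 * sqnorm2 (y - A *m x) +
  lambda * \sum_(i < n) (w i 0 * `|x i 0| + h (w i 0)).

(* Main.v *)
Require Import Defs.
From HB Require Import structures.
From mathcomp Require Import all_boot all_order all_algebra.
From mathcomp Require Import all_classical all_reals all_analysis.
From mathcomp Require Import ring lra.

Set Implicit Arguments.
Unset Strict Implicit.
Unset Printing Implicit Defensive.

Import Order.TTheory GRing.Theory Num.Theory.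
Import numFieldNormedType.Exports.

Local Open Scope classical_set_scope.
Local Open Scope ring_scope.

(** The one-sided form of Fermat's rule for relative derivatives drives
    everything. Applied to [c * u - g u] it yields the Darboux property of [g'],
    so that its range [H] is an interval. Applied to [h] minus a linear part it
    shows that [h], whose derivative [- (g')^-1] is strictly increasing, lies
    above its tangents. The tangent at [g' z] reads
    [h (g' z) + z * g' z <= h s + z * s]: it gives the convexity of [h], and with
    [z = |x_i|] it says that the IRL1 weight [g' |x_i|] is the exact minimiser of
    the functional in [w]. *)

(** * One-sided calculus on an interval *)

Section DerivativeOnInterval.
Variable R : realType.
Implicit Types (D : set R) (f df g dg : R -> R).

Lemma has_derivative_on_affine D f df (k c : R) :
  has_derivative_on D f df ->
  has_derivative_on D (fun u => k * f u + c * u) (fun u => k * df u + c).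
Proof.
move=> fdf z Dz.
have : k * ((f u - f z) / (u - z)) + c @[u --> within D z^'] --> k * df z + c.
  by apply: cvgD; [apply: cvgMl_tmp; exact: fdf|exact: cvg_cst].
apply: cvg_trans; apply: near_eq_cvg; rewrite near_withinE.
near=> u => Du.
have uz : u - z != 0 by rewrite subr_eq0; near: u; exact: nbhs_dnbhs_neq.
by field.
Unshelve. all: by end_near. Qed.

Lemma has_derivative_on_continuous D f df z :
  has_derivative_on D f df -> D z -> f @ within D (nbhs z) --> f z.
Proof.
move=> fdf Dz.
have fz : f @ within D z^' --> f z.
  have : (f u - f z) / (u - z) * (u - z) + f z @[u --> within D z^'] -->
      df z * (z - z) + f z.
    apply: cvgD; last exact: cvg_cst.
    apply: cvgM; first exact: fdf.
    apply: cvgB; last exact: cvg_cst.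
    by apply: cvg_within_filter; exact: cvg_within.
  rewrite subrr mulr0 add0r; apply: cvg_trans; apply: near_eq_cvg.
  rewrite near_withinE; near=> u => Du.
  have uz : u - z != 0 by rewrite subr_eq0; near: u; exact: nbhs_dnbhs_neq.
  by rewrite divfK// subrK.
(* The limit so far is over a punctured neighbourhood; [u = z] is added by hand. *)
apply/cvgrPdist_lt => e e0.
move/cvgrPdist_lt : fz => /(_ e e0); rewrite !near_withinE near_simpl => fz.
move: fz; rewrite /dnbhs /within /= !near_simpl => fz.
near=> u => Du.
have [->|uz] := eqVneq u z; first by rewrite subrr normr0.
by move: (uz) (Du); near: u; exact: fz.
Unshelve. all: by end_near. Qed.

(** Along [a + s * (b - a)] with [s] tending to 0 from the right, [b - a] times the difference
    quotient is [(f (a + s * (b - a)) - f a) / s], which is at least [k]. The sign of [b - a] is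
    free, so both sides of a point are covered. *)
Lemma derivative_on_ge D f df a b (k : R) :
  is_interval D -> has_derivative_on D f df -> D a -> D b ->
  (forall s, 0 < s <= 1 -> k * s <= f (a + s * (b - a)) - f a) ->
  k <= (b - a) * df a.
Proof.
move=> iD fdf Da Db fk.
have [ab|ab] := eqVneq b a.
  have := fk 1; rewrite ab subrr !(mul0r, mulr0, addr0) subrr mulr1.
  by apply; rewrite ltr01 lexx.
have ba0 : b - a != 0 by rewrite subr_eq0.
have path : (fun s : R => a + s * (b - a)) @ 0^'+ --> within D a^'.
  have pa : (fun s : R => a + s * (b - a)) @ 0^'+ --> a.
    suff : a + s * (b - a) @[s --> 0^'+] --> a + 0 * (b - a).
      by rewrite mul0r addr0.
    apply: cvgD; first exact: cvg_cst.
    by apply: cvgM; [apply: cvg_at_right_filter; exact: cvg_id|exact: cvg_cst].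
  move=> P; rewrite /within /dnbhs /within /= => /pa; rewrite !near_simpl.
  move=> PP; near=> s.
  have s0 : 0 < s by near: s; exact: nbhs_right_gt.
  have s1 : s < 1 by near: s; exact: nbhs_right_lt.
  have : a + s * (b - a) != a -> D (a + s * (b - a)) -> P (a + s * (b - a)).
    by near: s; exact: PP.
  apply.
    by rewrite -subr_eq0 addrAC subrr add0r mulf_neq0// gt_eqF.
  by have [ltab|ltba|/eqP] := ltgtP a b;
    [apply: (iD a b) => //; nra|apply: (iD b a) => //; nra|rewrite eq_sym (negbTE ab)].
have : (b - a) * ((f (a + s * (b - a)) - f a) / (a + s * (b - a) - a))
    @[s --> 0^'+] --> (b - a) * df a.
  by apply: cvgMl_tmp; exact: cvg_comp path (fdf _ Da).
move=> /cvgr_to_ge; apply.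
near=> s.
have s0 : 0 < s by near: s; exact: nbhs_right_gt.
have s1 : s < 1 by near: s; exact: nbhs_right_lt.
have -> : (b - a) * ((f (a + s * (b - a)) - f a) / (a + s * (b - a) - a)) =
    (f (a + s * (b - a)) - f a) / s.
  by field; rewrite gt_eqF//= addrAC subrr add0r mulf_neq0// gt_eqF.
by rewrite ler_pdivlMr// fk// s0 ltW.
Unshelve. all: by end_near. Qed.

(* Fermat's rule; the two inequalities cover an end point minimiser as well. *)
Lemma minimizer_on_segment D f df a b :
  is_interval D -> has_derivative_on D f df -> D a -> D b -> a <= b ->
  exists c, [/\ a <= c <= b, forall t, a <= t <= b -> f c <= f t,
    0 <= (a - c) * df c & 0 <= (b - c) * df c].
Proof.
move=> iD fdf Da Db ab.
have sub : `[a, b] `<=` D.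
  by move=> t /=; rewrite in_itv/=; exact: iD.
have cf : {within `[a, b], continuous f}.
  apply/subspace_continuousP => x xab.
  have := has_derivative_on_continuous fdf (sub _ xab).
  by apply: cvg_trans; apply: cvg_fmap2; exact: within_subset.
have [c cab cmin] := EVT_min ab cf.
rewrite in_itv/= in cab; have Dc : D c by exact: (iD a b).
have cmin' t : a <= t <= b -> f c <= f t by move=> tab; apply: cmin; rewrite in_itv.
exists c; split => //; apply: (derivative_on_ge iD fdf) => // s /andP[s0 s1];
  by rewrite mul0r subr_ge0; apply: cmin'; nra.
Qed.

(** For [c] strictly between [df b] and [df a], a minimiser of [c * u - f u] on the segment cannot
    be an end point, and Fermat's rule at an interior one gives [df x = c]. *)
Lemma derivative_on_darboux D f df :
  is_interval D -> has_derivative_on D f df ->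
  (forall a b, D a -> D b -> a < b -> df b < df a) ->
  is_interval (df @` D).
Proof.
move=> iD fdf dec _ _ [b Db <-] [a Da <-] c /andP[].
rewrite le_eqVlt => /predU1P[<- _|bc]; first by exists b.
rewrite le_eqVlt => /predU1P[->|ca]; first by exists a.
have ab : a < b.
  rewrite ltNge le_eqVlt; apply/negP => /predU1P[ba|/(dec _ _ Db Da)]; last lra.
  by move: bc ca; rewrite ba; lra.
have [x [/andP[ax xb] _ ge1 ge2]] := minimizer_on_segment iD
  (has_derivative_on_affine (k := -1) (c := c) fdf) Da Db (ltW ab).
exists x; first by apply: (iD a b) => //; rewrite ax.
move: ax xb; rewrite !le_eqVlt.
move=> /predU1P[ax|ax]; first by move: ge1 ge2; rewrite -ax; nra.
move=> /predU1P[xb|xb]; first by move: ge1 ge2; rewrite xb; nra.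
nra.
Qed.

(* A minimiser c of f minus its linear part at z satisfies
   (c - z) * (df c - df z) <= 0, hence c = z when df is strictly increasing. *)
Lemma tangent_le D f df z s :
  is_interval D -> has_derivative_on D f df ->
  (forall a b, D a -> D b -> a < b -> df a < df b) ->
  D z -> D s -> f z + df z * (s - z) <= f s.
Proof.
move=> iD fdf inc Dz Ds.
have fdf' := has_derivative_on_affine (k := 1) (c := - df z) fdf.
have key c : D c -> 0 <= (z - c) * (1 * df c - df z) -> c = z.
  move=> Dc; have [cz|zc|//] := ltgtP c z.
    by have := inc _ _ Dc Dz cz; nra.
  by have := inc _ _ Dz Dc zc; nra.
have [zs|/ltW sz] := leP z s.
  have [c [czs cmin ge1 _]] := minimizer_on_segment iD fdf' Dz Ds zs.
  have := cmin s; rewrite zs lexx => /(_ isT).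
  by rewrite (key c (iD _ _ Dz Ds _ czs) ge1); lra.
have [c [czs cmin _ ge2]] := minimizer_on_segment iD fdf' Ds Dz sz.
have := cmin s; rewrite sz lexx => /(_ isT).
by rewrite (key c (iD _ _ Ds Dz _ czs) ge2); lra.
Qed.

(** The graph lies strictly below each tangent away from the contact point; adding the tangent
    inequalities at [a] and at [b] compares the slopes. *)
Lemma strictly_concave_derivative_decreasing D g dg :
  is_interval D -> strictly_concave_on D g -> has_derivative_on D g dg ->
  forall a b, D a -> D b -> a < b -> dg b < dg a.
Proof.
move=> iD sc gdg.
have weak a b : D a -> D b -> g b - g a <= (b - a) * dg a.
  move=> Da Db; apply: (derivative_on_ge iD gdg) => // s /andP[s0].
  rewrite le_eqVlt => /predU1P[->|s1].
    by rewrite mul1r mulr1 (addrC a) subrK.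
  have [ba|ba] := eqVneq b a; first by rewrite ba !subrr mulr0 addr0 mul0r subrr.
  have := sc b a s Db Da ba s0 s1.
  have -> : s * b + (1 - s) * a = a + s * (b - a) by ring.
  by move=> lt; lra.
(* Passing to the limit loses strictness. It is regained from the weak inequality at the midpoint,
   where [g] exceeds the mean of its end values. *)
have strict a b : D a -> D b -> a != b -> g b - g a < (b - a) * dg a.
  move=> Da Db ab.
  have := sc a b 2^-1 Da Db ab; rewrite invr_gt0 invf_lt1// ltr1n ltr0n.
  move=> /(_ isT isT) lt.
  have Dc : D (2^-1 * a + (1 - 2^-1) * b).
    by have [ltab|ltba|/eqP] := ltgtP a b;
     [apply: (iD a b) => //; lra|apply: (iD b a) => //; lra|rewrite (negbTE ab)].
  by have := weak _ _ Da Dc; lra.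
move=> a b Da Db ab.
have := strict _ _ Da Db; rewrite lt_eqF// => /(_ isT) ?.
have := strict _ _ Db Da; rewrite gt_eqF// => /(_ isT) ?.
nra.
Qed.

(** Makes the weights nonnegative. As [z] may be an end point of [D], the quotient is taken towards
    whichever of [a], [b] differs from [z]. *)
Lemma increasing_derivative_ge0 D g dg :
  is_interval D -> (exists a b, [/\ D a, D b & a < b]) ->
  increasing_on D g -> has_derivative_on D g dg ->
  forall z, D z -> 0 <= dg z.
Proof.
move=> iD [a [b [Da Db ab]]] inc gdg z Dz.
have [zb|bz] := ltP z b.
  have : 0 <= (b - z) * dg z.
    apply: (derivative_on_ge iD gdg) => // s /andP[s0 s1].
    by rewrite mul0r subr_ge0 ltW// inc//; [apply: (iD z b) => //; nra|nra].
  by rewrite pmulr_rge0// subr_gt0.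
have az : a < z by exact: lt_le_trans bz.
have : 0 <= (a - z) * (- 1 * dg z + 0).
  apply: (derivative_on_ge iD (has_derivative_on_affine (k := -1) (c := 0) gdg)) => //.
  move=> s /andP[s0 s1].
  have : g (z + s * (a - z)) < g z.
    by rewrite inc//; [apply: (iD a z) => //; nra|nra].
  by rewrite mul0r; lra.
by rewrite nmulr_rge0 ?subr_lt0//; lra.
Qed.

End DerivativeOnInterval.

(** * Convexity of the terms in [x] *)

Lemma sqnorm2_convex (R : realType) (m : nat) (s : R) (a b : 'cV[R]_m) :
  0 <= s -> s <= 1 ->
  sqnorm2 (s *: a + (1 - s) *: b) <= s * sqnorm2 a + (1 - s) * sqnorm2 b.
Proof.
move=> s0 s1; rewrite /sqnorm2 !mulr_sumr -big_split/=.
apply: ler_sum => i _; rewrite !mxE -subr_ge0.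
have -> : s * a i 0 ^+ 2 + (1 - s) * b i 0 ^+ 2 -
    (s * a i 0 + (1 - s) * b i 0) ^+ 2 = s * (1 - s) * (a i 0 - b i 0) ^+ 2.
  by ring.
by rewrite mulr_ge0 ?sqr_ge0// mulr_ge0// subr_ge0.
Qed.

Lemma normr_convex (R : realType) (s a b : R) :
  0 <= s -> s <= 1 -> `|s * a + (1 - s) * b| <= s * `|a| + (1 - s) * `|b|.
Proof.
move=> s0 s1; rewrite (le_trans (ler_normD _ _))// !normrM (ger0_norm s0).
by rewrite (@ger0_norm _ (1 - s))// subr_ge0.
Qed.

Theorem theorem1 (R : realType) (m n : nat) (A : 'M[R]_(m, n)) (y : 'cV[R]_m)
    (lambda : R) (D H : set R) (g dg h : R -> R)
    (X Y : set 'cV[R]_n) :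
  0 < lambda ->
  (* the domain D of g is a nondegenerate interval of nonnegative reals *)
  (forall z, D z -> 0 <= z) ->
  is_interval D ->
  (exists a b, [/\ D a, D b & a < b]) ->
  strictly_concave_on D g ->
  increasing_on D g ->
  has_derivative_on D g dg ->
  (* h is defined on the domain H of the inverse of g' *)
  H = dg @` D ->
  (forall s, H s -> 0 <= h s) ->
  has_derivative_on H h (fun s => - 'pinv_(fun=> 0) D dg s) ->
  convex_set X ->
  Y = [set w : 'cV[R]_n | forall i, H (w i 0)] ->
  biconvex X Y (irl1_functional A y lambda h) /\
  (forall (T : nat) (x w : nat -> 'cV[R]_n),
    (forall t, (t <= T)%N -> X (x t)) ->
    lasso_irl1_run A y lambda D dg T x w ->
    acs_run X Y (irl1_functional A y lambda h) T x w).
Proof.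
move=> lambda0 _ iD neD sc inc gdg HE _ hdh cX YE.
have dec := strictly_concave_derivative_decreasing iD sc gdg.
have dgge0 := increasing_derivative_ge0 iD neD inc gdg.
have iH : is_interval H by rewrite HE; exact: derivative_on_darboux gdg dec.
(* Injectivity makes ['pinv_] a true inverse of [dg] on [H], where its default value 0 is never
   taken. *)
have dg_inj : {in D &, injective dg}.
  move=> a b /set_mem Da /set_mem Db ab; apply/eqP.
  have [/(dec _ _ Da Db)|/(dec _ _ Db Da)|//] := ltgtP a b;
    by rewrite ab ltxx.
have pinvE z : D z -> 'pinv_(fun=> 0) D dg (dg z) = z.
  by move=> Dz; rewrite pinvKV ?inE.
have dh_inc s t : H s -> H t -> s < t ->
    - 'pinv_(fun=> 0) D dg s < - 'pinv_(fun=> 0) D dg t.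
  rewrite HE => -[a Da <-] [b Db <-] st; rewrite !pinvE// ltrN2.
  have [//|ab|ab] := ltgtP b a; last by move: st; rewrite ab ltxx.
  by have := lt_trans st (dec _ _ Da Db ab); rewrite ltxx.
have tangent z s : D z -> H s -> h (dg z) - z * (s - dg z) <= h s.
  move=> Dz Hs; have Hz : H (dg z) by rewrite HE; exists z.
  by have := tangent_le iH hdh dh_inc Hz Hs; rewrite pinvE// mulNr.
have h_conv s a b : 0 <= s -> s <= 1 -> H a -> H b ->
    H (s * a + (1 - s) * b) /\
    h (s * a + (1 - s) * b) <= s * h a + (1 - s) * h b.
  move=> s0 s1 Ha Hb.
  have Hc : H (s * a + (1 - s) * b).
    by have [ab|/ltW ba] := leP a b;
      [apply: (iH a b) => //|apply: (iH b a) => //]; nra.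
  (* The tangent at the convex combination, evaluated at [a] and [b] with weights [s] and [1 - s],
     has linear parts that cancel. *)
  split => //; move: (Hc); rewrite {1}HE => -[z Dz zE].
  have := tangent z a Dz Ha; have := tangent z b Dz Hb; rewrite zE.
  move: (h _) (h a) (h b) => ha hb hc lea leb.
  have := ler_wpM2l s0 leb; have : 0 <= 1 - s by rewrite subr_ge0.
  by move/ler_wpM2l => /(_ _ _ lea); lra.
split.
  split => //.
  - move=> v w p; rewrite YE !inE/= => Yv Yw i.
    by rewrite !mxE; apply: (h_conv _ _ _ _ _ (Yv i) (Yw i)).1.
  - move=> u _ p v w; rewrite YE !inE/= => Yv Yw.
    have p0 : 0 <= p%:num by [].
    have p1 : p%:num <= 1 by [].
    (* The data term does not depend on the weights, so only the sum remains, to be compared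
       coordinatewise. *)
    rewrite convRE /irl1_functional [leRHS](_ : _ = 2^-1 * sqnorm2 (y - A *m u) +
      lambda * \sum_(i < n) (p%:num * (v i 0 * `|u i 0| + h (v i 0)) +
        (1 - p%:num) * (w i 0 * `|u i 0| + h (w i 0)))); last first.
      by rewrite [in RHS]big_split/= -!mulr_sumr /unstable.onem; ring.
    rewrite lerD2l ler_pM2l//; apply: ler_sum => i _; rewrite !mxE.
    have := (h_conv p%:num _ _ _ _ (Yv i) (Yw i)).2; rewrite /unstable.onem.
    by move=> /(_ p0 p1); lra.
  - move=> v; rewrite YE => Yv p x1 x2 _ _; rewrite convRE /irl1_functional.
    have p0 : 0 <= p%:num by [].
    have p1 : p%:num <= 1 by [].
    have v0 i : 0 <= v i 0.
      by have := Yv i; rewrite HE => -[z Dz <-]; exact: dgge0.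
    have sq := sqnorm2_convex (y - A *m x1) (y - A *m x2) p0 p1.
    have sm : \sum_(i < n) (v i 0 * `|(p%:num *: x1 + (1 - p%:num) *: x2) i 0|
        + h (v i 0)) <= p%:num * \sum_(i < n) (v i 0 * `|x1 i 0| + h (v i 0)) +
        (1 - p%:num) * \sum_(i < n) (v i 0 * `|x2 i 0| + h (v i 0)).
      rewrite !mulr_sumr -big_split/=; apply: ler_sum => i _; rewrite !mxE.
      have := ler_wpM2l (v0 i) (normr_convex (x1 i 0) (x2 i 0) p0 p1).
      by lra.
    (* The residual is affine in [x], as the coefficients sum to 1. *)
    have resE : y - A *m (p%:num *: x1 + (1 - p%:num) *: x2) =
        p%:num *: (y - A *m x1) + (1 - p%:num) *: (y - A *m x2).
      rewrite mulmxDr -!scalemxAr !scalerBr addrACA -scalerDl.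
      by rewrite [_ + (1 - _)]addrC subrK scale1r opprD.
    rewrite -resE in sq.
    by move: sq (ler_wpM2l (ltW lambda0) sm); rewrite /unstable.onem; lra.
move=> T x w xX run; split; first exact: xX.
move=> t tT; have [wE [_ xmin]] := run t tT; split; split.
- by rewrite YE => i; have [Dx ->] := wE i; rewrite HE; exists `|x t i 0|.
(* The functional separates over the coordinates of the weight, and the tangent inequality at
   [z = |x_i|] minimises each summand. *)
- move=> v; rewrite YE => Yv; rewrite lerD2l ler_pM2l//.
  apply: ler_sum => i _; have [Dx ->] := wE i.
  by have := tangent _ _ Dx (Yv i); lra.
- exact: xX.
(* For fixed weights the functional is the weighted Lasso objective plus a constant, so a minimiser
   over the whole space that lies in [X] is one over [X]. *)
- move=> v _; have := xmin v I; rewrite /weighted_lasso /irl1_functional.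
  by rewrite !big_split/= !mulrDr; lra.
Qed.
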